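(* Let $\mathcal{R}$ be a $2$-torsionfree commutative domain and let $\mathcal{M}_n(\mathcal{R})$ be the full matrix algebra over $\mathcal{R}$. Suppose that $\mathfrak{q}\colon\mathcal{M}_n(\mathcal{R})\times\mathcal{M}_n(\mathcal{R})\to\mathcal{M}_n(\mathcal{R})$ is an $\mathcal{R}$-bilinear mapping. Then every centralizing trace $\mathfrak{T}_{\mathfrak{q}}\colon\mathcal{M}_n(\mathcal{R})\to\mathcal{M}_n(\mathcal{R})$ of $\mathfrak{q}$ is proper.
   Context: $\mathcal{M}_n(\mathcal{R})$ is the algebra of all $n\times n$ matrices over $\mathcal{R}$. $\mathcal{Z}(\cdot)$ denotes the center and $[x,y]=xy-yx$. $2$-torsionfree means $2x=0$ implies $x=0$. The trace of an $\mathcal R$-bilinear map $\mathfrak{q}\colon \mathcal A\times\mathcal A\to\mathcal A$ on a unital $\mathcal R$-algebra $\mathcal{A}$ is the map $\mathfrak{T}_{\mathfrak{q}}(a)=\mathfrak{q}(a,a)$; it is centralizing if $[\mathfrak{T}_{\mathfrak{q}}(a),a]\in\mathcal{Z}(\mathcal{A})$ for all $a$, and a centralizing trace is proper if $\mathfrak{T}_{\mathfrak{q}}(a)=za^2+\mu(a)a+\nu(a)$ for all $a$, where $z\in\mathcal{Z}(\mathcal{A})$, $\mu\colon\mathcal{A}\to\mathcal{Z}(\mathcal{A})$ is $\mathcal R$-linear, and $\nu\colon\mathcal{A}\to\mathcal{Z}(\mathcal{A})$ is the trace of an $\mathcal R$-bilinear map $\mathcal{A}\times\mathcal{A}\to\mathcal{Z}(\mathcal{A})$.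 *)

(* Defs.v *)
From HB Require Import structures.
From mathcomp Require Import all_boot all_order all_algebra.

Set Implicit Arguments.
Unset Strict Implicit.
Unset Printing Implicit Defensive.

Import GRing.Theory.
Local Open Scope ring_scope.

Definition two_torsionfree (V : zmodType) : Prop :=
  forall x : V, x *+ 2 = 0 -> x = 0.

Section Traces.

Variables (R : comNzRingType) (A : algType R).

Definition lie_bracket (x y : A) : A := x * y - y * x.

Definition in_center (x : A) : Prop := forall y : A, GRing.comm x y.

Definition bitrace (q : {bilinear A -> A -> A}) (a : A) : A := q a a.

Definition centralizing_trace (T : A -> A) : Prop :=
  forall a : A, in_center (lie_bracket (T a) a).

(* Since the center is an R-submodule of A, R-(bi)linear maps into the center
   are encoded as R-(bi)linear maps into A all of whose values are central. *)
Definition proper_trace (T : A -> A) : Prop :=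
  exists (z : A) (mu : {linear A -> A}) (p : {bilinear A -> A -> A}),
    [/\ in_center z,
        forall a : A, in_center (mu a),
        forall a b : A, in_center (p a b)
      & forall a : A, T a = z * a ^+ 2 + mu a * a + bitrace p a].

End Traces.

(* Main.v *)
Require Import Defs.
From HB Require Import structures.
From mathcomp Require Import all_boot all_order all_algebra ring.

Set Implicit Arguments.
Unset Strict Implicit.
Unset Printing Implicit Defensive.

Import GRing.Theory.
Local Open Scope ring_scope.

(** Write T(a) = q(a, a), B(a, b) = q(a, b) + q(b, a), E_i for the diagonal
    matrix units and e_kl for the off-diagonal ones.  Since a central matrix is
    diagonal, the hypothesis says that the off-diagonal entries of [T(a), a]
    vanish, and this alone implies the conclusion ([offdiag_commuting_proper]).
    Comparing a + b with a - b and dividing by 2 linearises it: off the diagonal,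
    [T(a), b] + [B(a, b), a] vanishes, and so does the cyclic sum of
    [B(a, b), c].  No division by 3 is ever made, so characteristic 3 and
    finite R are covered.

    The idea is to look at diagonal arguments D = sum_i x_i E_i first.  There
    T(D) is diagonal, and testing the linearised identity on e_kl gives
    T(D)_kk - T(D)_ll = (x_k - x_l) g_kl(x), where g_kl is the linear form
    x |-> B(D, e_kl)_kl.  Adding these equalities around a triangle k, l, p and
    comparing the coefficients of the monomials x_i x_j forces
    g_kl(x) = mu(x) + z (x_k + x_l) for one scalar z and one linear form mu,
    independent of k and l ([gap_coefE]).  This is what T(a) = z a^2 + mu(a) a
    yields, so replacing q(a, b) by q(a, b) - z a b - mu(a) b makes every g_kl
    vanish, without changing [T(a), a] or the properness of T.

    Now T(D) is scalar, hence commutes with everything, and for arbitrary b the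
    same reasoning with B(D, b) in place of T(D) gives B(D, b) = w(b) D up to
    scalar matrices, with w linear and zero on diagonal matrices
    ([polar_unitlE]).  Subtracting w(a) b from q makes every B(D, b) scalar.
    Then the linearised identity for (b, E_l) shows that T(b) is diagonal, and
    the one for (b, e_kl), or [T(b), b] itself when b_kl <> 0, that its diagonal
    entries agree ([polar_scalar_trace]).  So T(b) is scalar for all b, and then
    nu(a) is the trace of the bilinear map sending (a, b) to the scalar matrix
    whose entry is that of q(a, b) at (0, 0). *)

(** * Brackets of matrices *)

Section Bracket.
Variables (R : comNzRingType) (A : algType R).
Implicit Types x y : A.

Lemma lie_bracketDl x x' y :
  lie_bracket (x + x') y = lie_bracket x y + lie_bracket x' y.
Proof. by rewrite /lie_bracket mulrDl mulrDr opprD addrACA. Qed.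

Lemma lie_bracketDr x y y' :
  lie_bracket x (y + y') = lie_bracket x y + lie_bracket x y'.
Proof. by rewrite /lie_bracket mulrDl mulrDr opprD addrACA. Qed.

Lemma lie_bracketNl x y : lie_bracket (- x) y = - lie_bracket x y.
Proof. by rewrite /lie_bracket mulNr mulrN opprD. Qed.

Lemma lie_bracketNr x y : lie_bracket x (- y) = - lie_bracket x y.
Proof. by rewrite /lie_bracket mulNr mulrN opprD. Qed.

End Bracket.

Section BracketEntries.
Variables (R : comNzRingType) (m : nat).
Local Notation A := 'M[R]_m.+1.
Implicit Types x y : A.

Lemma lie_bracket_diagE x y k l : is_diag_mx x ->
  lie_bracket x y k l = (x k k - x l l) * y k l.
Proof.
move=> /diag_mxP[d ->].
rewrite /lie_bracket -[_ * y]/(_ *m y) -[y * _]/(y *m _) mul_diag_mx mul_mx_diag.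
by rewrite !mxE !eqxx !mulr1n; ring.
Qed.

Lemma offdiagP x :
  reflect (forall k l, k != l -> x k l = 0) (is_diag_mx x).
Proof. exact: is_diag_mxP. Qed.

Lemma delta_mx_diag i : is_diag_mx (delta_mx i i : A).
Proof.
apply/is_diag_mxP => k l; rewrite mxE.
by case: (k =P i) => [->|//]; case: (l =P i) => [->|//]; rewrite eqxx.
Qed.

Lemma delta_mx_supp k l : (delta_mx k l : A) k l = 1.
Proof. by rewrite mxE !eqxx. Qed.

(** Bracketing with E_i only rescales entries, which is what makes
    the diagonal matrix units such good test arguments. *)
Lemma lie_bracket_unitE x i k l :
  lie_bracket x (delta_mx i i) k l = ((i == l)%:R - (i == k)%:R) * x k l.
Proof.
have -> : lie_bracket x (delta_mx i i) = - lie_bracket (delta_mx i i) x.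
  by rewrite /lie_bracket opprB.
rewrite mxE lie_bracket_diagE ?delta_mx_diag // !mxE !andbb (eq_sym k) (eq_sym l).
by ring.
Qed.

Lemma central_offdiag x k l : in_center x -> k != l -> x k l = 0.
Proof.
move=> cx nkl; have /matrixP/(_ k l) := cx (delta_mx l l).
move/eqP; rewrite -subr_eq0 => /eqP.
have := lie_bracket_unitE x l k l; rewrite /lie_bracket !mxE => -> .
by rewrite eqxx (eq_sym l) (negPf nkl) subr0 mul1r.
Qed.

Lemma scalar_mx_center a : in_center (a%:M : A).
Proof. by move=> y; apply/esym/scalar_mxC. Qed.

Lemma is_scalar_mx_center x : is_scalar_mx x -> in_center x.
Proof. by move=> /is_scalar_mxP[a ->]; apply: scalar_mx_center. Qed.

Lemma scalar_bracket x y : is_scalar_mx x -> lie_bracket x y = 0.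
Proof. by move=> /is_scalar_mx_center xC; rewrite /lie_bracket xC subrr. Qed.

Lemma diag_const_scalar x : is_diag_mx x ->
  (forall k l, k != l -> x k k = x l l) -> is_scalar_mx x.
Proof.
move=> /is_diag_mxP dx cx; apply/is_scalar_mxP; exists (x 0 0).
apply/matrixP => k l; rewrite mxE; have [<-|nkl] := eqVneq k l; last exact: dx.
by rewrite mulr1n; have [->|] := eqVneq k 0; last exact: cx.
Qed.

Lemma scalar_diag_eq x k l : is_scalar_mx x -> x k k = x l l.
Proof. by move=> /is_scalar_mxP[a ->]; rewrite !mxE !eqxx. Qed.

End BracketEntries.

(** * Linearising the commutation identity *)

Section Polarization.
Variables (R : idomainType) (hR : two_torsionfree R) (m : nat).
Local Notation A := 'M[R]_m.+1.

Definition offdiag_commuting (q : A -> A -> A) :=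
  forall a k l, k != l -> lie_bracket (q a a) a k l = 0.

Variable q : {bilinear A -> A -> A}.
Hypothesis qC : offdiag_commuting q.

Definition polar (f : A -> A -> A) a b := f a b + f b a.

Lemma polarC (f : A -> A -> A) a b : polar f a b = polar f b a.
Proof. exact: addrC. Qed.

(** This is half of the identity at a + b minus the one at a - b, once the
    identity at b is taken off. *)
Lemma polarization2 a b k l : k != l ->
  lie_bracket (q a a) b k l + lie_bracket (polar q a b) a k l = 0.
Proof.
move=> nkl; apply: hR.
have := qC (a - b) nkl; have := qC (a + b) nkl; have := qC b nkl.
rewrite /polar !(linearDl, linearDr, linearNl, linearNr) /=.
rewrite !(lie_bracketDl, lie_bracketDr, lie_bracketNl, lie_bracketNr).
rewrite !mxE => bb plus minus.
have comb (x y z : R) : x = 0 -> y = 0 -> z = 0 -> x - y - z *+ 2 = 0.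
  by move=> -> -> ->; rewrite mul0rn !subr0.
by apply: etrans (comb _ _ _ plus minus bb); ring.
Qed.

(** Full linearisation of the previous identity in its quadratic argument. *)
Lemma polarization3 a b c k l : k != l ->
  lie_bracket (polar q a b) c k l + lie_bracket (polar q b c) a k l
    + lie_bracket (polar q c a) b k l = 0.
Proof.
move=> nkl.
have := polarization2 (a + c) b nkl.
have := polarization2 a b nkl; have := polarization2 c b nkl.
rewrite /polar !(linearDl, linearDr) /= !(lie_bracketDl, lie_bracketDr) !mxE.
move=> cb ab sum.
have comb (x y z : R) : x = 0 -> y = 0 -> z = 0 -> x - y - z = 0.
  by move=> -> -> ->; rewrite !subr0.
by apply: etrans (comb _ _ _ sum ab cb); ring.
Qed.

(** * The trace on diagonal matrices *)

Local Notation E i := (delta_mx i i : A).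

Lemma unit_sign_l (k l : 'I_m.+1) : k != l -> (l == l)%:R - (l == k)%:R = 1 :> R.
Proof. by move=> nkl; rewrite eqxx eq_sym (negPf nkl) subr0. Qed.

(** At the entry (k, l) the test matrix E_l isolates the trace, because it is
    multiplied there by 1; only i = k and i = l, where the polar term survives,
    need the unlinearised identity. *)
Lemma trace_unit_diag i : is_diag_mx (q (E i) (E i)).
Proof.
apply/offdiagP => k l nkl.
have := qC (E i) nkl; have := polarization2 (E i) (E l) nkl.
have := qC (E l) nkl.
rewrite !lie_bracket_unitE unit_sign_l // !mul1r.
have [->//|nil] := eqVneq i l.
have [->|nik] := eqVneq i k.
  by rewrite sub0r !mulN1r => _ _ /eqP; rewrite oppr_eq0 => /eqP.
by rewrite subrr mul0r addr0 => _ ->.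
Qed.

Lemma polar_unit_diag i j : is_diag_mx (polar q (E i) (E j)).
Proof.
apply/offdiagP => k l nkl.
have polar_l p : polar q (E l) (E p) k l = 0.
  have := polarization2 (E l) (E p) nkl.
  rewrite !lie_bracket_unitE unit_sign_l // mul1r.
  by rewrite (offdiagP _ (trace_unit_diag l)) // mulr0 add0r.
have := polarization3 (E i) (E j) (E l) nkl.
rewrite !lie_bracket_unitE unit_sign_l // mul1r.
by rewrite (polarC q (E j)) !polar_l !mulr0 !addr0.
Qed.

(** The coefficient of x_i in the linear form g_kl such that
    T(D)_kk - T(D)_ll = (x_k - x_l) g_kl(x) for D = sum_i x_i E_i. The two lemmas
    that follow are this equality, coefficient by coefficient. *)
Definition gap_coef k l i := polar q (E i) (delta_mx k l) k l.

Lemma trace_unit_gap i k l : k != l ->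
  q (E i) (E i) k k - q (E i) (E i) l l
    = ((i == k)%:R - (i == l)%:R) * gap_coef k l i.
Proof.
move=> nkl; have := polarization2 (E i) (delta_mx k l) nkl.
rewrite lie_bracket_diagE ?trace_unit_diag // lie_bracket_unitE delta_mx_supp mulr1.
by rewrite -/(gap_coef k l i) => /eqP; rewrite addr_eq0 -mulNr opprB => /eqP.
Qed.

Lemma polar_unit_gap i j k l : k != l ->
  polar q (E i) (E j) k k - polar q (E i) (E j) l l
    = ((i == k)%:R - (i == l)%:R) * gap_coef k l j
      + ((j == k)%:R - (j == l)%:R) * gap_coef k l i.
Proof.
move=> nkl; have := polarization3 (E i) (E j) (delta_mx k l) nkl.
rewrite lie_bracket_diagE ?polar_unit_diag // !lie_bracket_unitE delta_mx_supp mulr1.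
rewrite (polarC q (delta_mx k l)) -!/(gap_coef k l _) -addrA => /eqP.
by rewrite addr_eq0 opprD -!mulNr !opprB => /eqP.
Qed.

Definition outside (i k l : 'I_m.+1) := (i != k) && (i != l).

(** The monomial x_i x_l of (x_k - x_l) g_kl(x) and of (x_l - x_k) g_lk(x). *)
Lemma gap_outsideE k l i : k != l -> outside i k l ->
  gap_coef k l i = polar q (E i) (E l) l l - polar q (E i) (E l) k k
  /\ gap_coef l k i = polar q (E i) (E l) l l - polar q (E i) (E l) k k.
Proof.
move=> nkl /andP[/negPf nik /negPf nil].
have nlk : l != k by rewrite eq_sym.
split; first rewrite -opprB.
  by rewrite polar_unit_gap // nik nil eqxx (negPf nlk) /=; ring.
by rewrite polar_unit_gap // nik nil eqxx (negPf nlk) /=; ring.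
Qed.

Lemma gap_outside_sym k l i : k != l -> outside i k l ->
  gap_coef k l i = gap_coef l k i.
Proof. by move=> nkl ikl; have [-> ->] := gap_outsideE nkl ikl. Qed.

(** The diagonal entries k and k' of B(E_i, E_l) agree, as i and l avoid both. *)
Lemma gap_outside_l k k' l i : k != l -> k' != l ->
  outside i k l -> outside i k' l -> gap_coef k l i = gap_coef k' l i.
Proof.
move=> nkl nk'l ikl ik'l; have [<-//|nkk'] := eqVneq k k'.
have [-> _] := gap_outsideE nkl ikl; have [-> _] := gap_outsideE nk'l ik'l.
congr (_ - _); apply/eqP; rewrite -subr_eq0 polar_unit_gap //.
case/andP: ikl ik'l => /negPf-> _ /andP[/negPf-> _].
by rewrite !(eq_sym l) (negPf nkl) (negPf nk'l) !subrr !mul0r addr0.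
Qed.

(** The squares x_l^2 and x_k^2 in (x_k - x_l) g_kl(x). *)
Lemma gap_inside k l : k != l ->
  gap_coef k l l = q (E l) (E l) l l - q (E l) (E l) k k
  /\ gap_coef k l k = q (E k) (E k) k k - q (E k) (E k) l l.
Proof.
move=> nkl; have nlk : l != k by rewrite eq_sym.
split; first rewrite -opprB.
  by rewrite trace_unit_gap // eqxx (negPf nlk) /=; ring.
by rewrite trace_unit_gap // eqxx (negPf nkl) /=; ring.
Qed.

(** The monomial x_k x_l in (x_k - x_l) g_kl(x). *)
Lemma gap_inside_diff k l : k != l ->
  gap_coef k l l - gap_coef k l k
    = polar q (E k) (E l) k k - polar q (E k) (E l) l l.
Proof.
move=> nkl; have nlk : l != k by rewrite eq_sym.
by rewrite polar_unit_gap // !eqxx (negPf nkl) (negPf nlk) /=; ring.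
Qed.

(** T(E_i) has equal diagonal entries away from i. *)
Lemma gap_inside_const i : exists r, forall k, k != i ->
  gap_coef k i i = r /\ gap_coef i k i = r.
Proof.
have [j nji|noj] := pickP (fun j => j != i); last first.
  by exists 0 => k; rewrite noj.
exists (q (E i) (E i) i i - q (E i) (E i) j j) => k nki.
have -> : q (E i) (E i) j j = q (E i) (E i) k k.
  have [->//|njk] := eqVneq j k; apply/eqP; rewrite -subr_eq0.
  by rewrite trace_unit_gap // !(eq_sym i) (negPf nji) (negPf nki) subrr mul0r.
have [-> _] := gap_inside nki; split=> //.
by rewrite eq_sym in nki; have [_ ->] := gap_inside nki.
Qed.

(** Two pairs avoiding i are joined by replacing one index at a time; swapping
    k and l first, if necessary, keeps the intermediate pair (l', k)
    nondegenerate. *)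
Lemma gap_outside_const i k k' l l' : k != l -> k' != l' -> outside i k l ->
  outside i k' l' -> gap_coef k l i = gap_coef k' l' i.
Proof.
wlog nkl' : k l / k != l' => [W|] nkl nk'l' ikl ik'l'.
  have [ekl'|nkl'] := eqVneq k l'; last exact: W.
  rewrite gap_outside_sym //; apply: W => //; rewrite 1?eq_sym //.
    by rewrite -ekl'.
  by move: ikl; rewrite /outside andbC.
have [/andP[nik nil] /andP[nik' nil']] := (ikl, ik'l').
rewrite gap_outside_sym // (@gap_outside_l l l') // 1?eq_sym /outside ?nil ?nik ?nil' //.
rewrite gap_outside_sym // 1?eq_sym /outside ?nil' ?nik //.
by apply: gap_outside_l => //; rewrite /outside nik.
Qed.

(** Let rho_i be the common value of the coefficients of x_i in the forms g_ij
    and g_ji. For i outside {k, l} the defect rho_i - gap_coef k l i depends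
    neither on k and l nor, by the symmetry established first, on i: it is z.
    Then mu_i = rho_i - z. *)
Lemma gap_coefE : exists (z : R) (mu : 'I_m.+1 -> R), forall k l i, k != l ->
  gap_coef k l i = z * ((i == k)%:R + (i == l)%:R) + mu i.
Proof.
have [rho rhoP] : exists rho : 'I_m.+1 -> R, forall i k, k != i ->
    gap_coef k i i = rho i /\ gap_coef i k i = rho i.
  have [rho rhoP] := fin_all_exists gap_inside_const.
  by exists rho => i k; apply: rhoP.
have swap i j p : j != p -> outside i j p ->
    rho i - gap_coef j p i = rho j - gap_coef i p j.
  move=> njp /andP[nij nip].
  have nji : j != i by rewrite eq_sym.
  have := gap_inside_diff nij.
  have [-> _] := rhoP j _ nij; have [_ ->] := rhoP i _ nji => rji.
  have pji : outside j p i by rewrite /outside njp.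
  have pij : outside i p j by rewrite /outside nip.
  have npi : p != i by rewrite eq_sym.
  have npj : p != j by rewrite eq_sym.
  have [_ ->] := gap_outsideE npi pji.
  have [_ ->] := gap_outsideE npj pij.
  apply/eqP; rewrite -subr_eq0 -[X in _ == X](subrr (rho j - rho i)) {1}rji.
  by rewrite (polarC q (E j) (E i)); apply/eqP; ring.
pose triple (t : 'I_m.+1 * 'I_m.+1 * 'I_m.+1) :=
  (t.1.1 != t.1.2) && outside t.2 t.1.1 t.1.2.
(* Without three distinct indices no defect exists, and z = 0 will do. *)
have [[[k0 l0] i0] /andP[/= nkl0 out0]|notriple] := pickP triple; last first.
  exists 0, rho => k l i nkl; rewrite mul0r add0r.
  have [->|nik] := eqVneq i k; first by have [] := rhoP k l; rewrite // eq_sym.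
  have [->|nil] := eqVneq i l; first by have [] := rhoP l k.
  by have := notriple (k, l, i); rewrite /triple /outside /= nkl nik nil.
pose z := rho i0 - gap_coef k0 l0 i0.
have zP i k l : k != l -> outside i k l -> rho i - gap_coef k l i = z.
  move=> nkl out; have [eii0|nii0] := eqVneq i i0.
    by rewrite eii0 /z -(@gap_outside_const i0 k k0 l l0) // -eii0.
  (* {i0, p} avoids i and {i, p} avoids i0, so [swap] relates i to i0. *)
  pose p := if k == i0 then l else k.
  have [nip nipp] : p != i0 /\ i != p.
    case/andP: out => nik nil; rewrite /p; have [<-|//] := eqVneq k i0.
    by rewrite eq_sym.
  have ni0p : i0 != p by rewrite eq_sym.
  have out1 : outside i i0 p by rewrite /outside nii0.
  rewrite (@gap_outside_const i k i0 l p) // swap //.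
  by rewrite (@gap_outside_const i0 i k0 p l0) // /outside eq_sym nii0.
exists z, (fun i => rho i - z) => k l i nkl.
have nlk : l != k by rewrite eq_sym.
have [->|nik] := eqVneq i k.
  by have [_ ->] := rhoP k l nlk; rewrite (negPf nkl) /=; ring.
have [->|nil] := eqVneq i l; last first.
  by rewrite -(zP i k l nkl) /outside ?nik //=; ring.
by have [-> _] := rhoP l k nkl; rewrite /=; ring.
Qed.

(** * Mixed terms with a diagonal argument *)

Section Reduced.
Hypothesis gap0 : forall k l i, k != l -> gap_coef k l i = 0.

Lemma trace_unit_scalar i : is_scalar_mx (q (E i) (E i)).
Proof.
apply: diag_const_scalar (trace_unit_diag i) _ => k l nkl.
by apply/eqP; rewrite -subr_eq0 trace_unit_gap // gap0 // mulr0.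
Qed.

Lemma polar_unit_scalar i j : is_scalar_mx (polar q (E i) (E j)).
Proof.
apply: diag_const_scalar (polar_unit_diag i j) _ => k l nkl.
by apply/eqP; rewrite -subr_eq0 polar_unit_gap // !gap0 // !mulr0 addr0.
Qed.

(** E_l isolates the entry (k, l), as for the trace of diagonal units: the brackets
    of the scalar matrices T(E_l) and B(E_i, E_l) with b drop out. *)
Lemma polar_unitl_diag i b : is_diag_mx (polar q (E i) b).
Proof.
apply/offdiagP => k l nkl.
have sl : polar q (E l) b k l = 0.
  have := polarization2 (E l) b nkl.
  rewrite scalar_bracket ?trace_unit_scalar // lie_bracket_unitE unit_sign_l //.
  by rewrite mul1r mxE add0r.
have := polarization3 (E i) (E l) b nkl.
rewrite scalar_bracket ?polar_unit_scalar // !lie_bracket_unitE unit_sign_l //.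
by rewrite (polarC q b) sl mulr0 mul1r mxE !add0r.
Qed.

(** The candidate for the scalar w(b) with B(E_i, b) = w(b) E_i + scalar, read off
    the entries k and l for i = l. *)
Definition weight k l b := polar q (E l) b l l - polar q (E l) b k k.

(** The entry (k, l) of a linearised identity says that the left-hand side, times
    a nonzero scalar, is the coefficient of x_i in (x_k - x_l) c with c
    independent of i; taking i = l then identifies c. The identity to use is the
    one for (b, E_i) when b_kl <> 0, and the one for (E_i, b, e_kl) when
    b_kl = 0, as the term B(e_kl, E_i), multiplied by b_kl, then disappears. *)
Lemma polar_unit_weight i b k l : k != l ->
  polar q (E i) b k k - polar q (E i) b l l
    = ((i == k)%:R - (i == l)%:R) * weight k l b.
Proof.
move=> nkl; pose d (j : 'I_m.+1) : R := (j == l)%:R - (j == k)%:R.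
suff eq_d j : polar q (E j) b k k - polar q (E j) b l l
    = d j * (polar q (E l) b k k - polar q (E l) b l l).
  by rewrite eq_d /d /weight; ring.
have [b0|nb0] := eqVneq (b k l) 0.
  have lin p : polar q (E p) b k k - polar q (E p) b l l
      = - d p * polar q b (delta_mx k l) k l.
    have := polarization3 (E p) b (delta_mx k l) nkl.
    rewrite lie_bracket_unitE (polarC q _ (E p)) !lie_bracket_diagE ?polar_unitl_diag //.
    rewrite b0 delta_mx_supp mulr0 mulr1 addr0.
    by move/eqP; rewrite addr_eq0 -mulNr => /eqP.
  by rewrite lin [in RHS]lin /d unit_sign_l //; ring.
apply: (mulIf nb0).
have lin p : (polar q (E p) b k k - polar q (E p) b l l) * b k l
      = - d p * q b b k l.
  have := polarization2 b (E p) nkl.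
  rewrite lie_bracket_unitE (polarC q b) lie_bracket_diagE ?polar_unitl_diag //.
  by rewrite [_ + (_ - _) * _]addrC => /eqP; rewrite addr_eq0 -mulNr => /eqP.
by rewrite -mulrA !lin /d unit_sign_l //; ring.
Qed.

Lemma weight_sym k l b : k != l -> weight k l b = weight l k b.
Proof.
move=> nkl; have nlk : l != k by rewrite eq_sym.
rewrite /weight -[RHS]opprB !polar_unit_weight // !eqxx (negPf nkl) (negPf nlk) /=.
by ring.
Qed.

(** The diagonal of B(E_l, b) is constant away from l. *)
Lemma weight_next k l p b : k != l -> p != l -> weight k l b = weight l p b.
Proof.
move=> nkl npl; have [<-|nkp] := eqVneq k p; first exact: weight_sym.
have nlp : l != p by rewrite eq_sym.
have := polar_unit_weight l b nkp; have := polar_unit_weight l b nlp.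
rewrite -/(weight k l b) eqxx (eq_sym l k) (negPf nkl) (negPf nlp) subrr mul0r.
rewrite subr0 mul1r.
by move=> <- /eqP; rewrite subr_eq0 /weight => /eqP ->.
Qed.

Lemma weight_const k l k' l' b : k != l -> k' != l' ->
  weight k l b = weight k' l' b.
Proof.
move=> nkl nk'l'; have [ll'|nll'] := eqVneq l l'.
  have nk'l : k' != l by rewrite ll'.
  by rewrite (weight_next b nkl nk'l) ll' weight_sym // eq_sym.
rewrite (@weight_next k l l') // 1?eq_sym //.
by rewrite (@weight_next l l' k') // weight_sym // eq_sym.
Qed.

Lemma weight_is_linear k l : linear_for *%R (weight k l).
Proof.
move=> c x y; rewrite /weight /polar !linearDl !linearDr /= !linearZl !linearZr /=.
by rewrite !mxE; ring.
Qed.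

HB.instance Definition _ k l :=
  GRing.isLinear.Build R A R *%R (weight k l) (weight_is_linear k l).

Lemma polar_unitlE : exists w : {scalar A},
  (forall i, w (E i) = 0) /\
  forall i b, is_scalar_mx (polar q (E i) b - w b *: E i).
Proof.
(* For 1 x 1 matrices 0 = ord_max and this weight is zero, as it should be. *)
exists (weight 0 ord_max : {scalar A}); split=> [i|i b] /=.
  by apply/eqP; rewrite subr_eq0; apply/eqP/scalar_diag_eq/polar_unit_scalar.
have dE := offdiagP _ (delta_mx_diag R i).
apply: diag_const_scalar => [|k l nkl].
  apply/offdiagP => k l nkl.
  by rewrite mxE (offdiagP _ (polar_unitl_diag i b)) // 2!mxE dE // mulr0 subr0.
have n0max : (0 : 'I_m.+1) != ord_max.
  apply: contraNneq nkl => /(congr1 val) /= m0; apply/eqP/val_inj.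
  have val0 (j : 'I_m.+1) : j = 0%N :> nat.
    by apply/eqP; rewrite -leqn0; apply: leq_trans (leq_ord j) _; rewrite -m0.
  by rewrite /= !val0.
apply/eqP; rewrite -subr_eq0.
have -> (x y : A) : (x - y) k k - (x - y) l l = (x k k - x l l) - (y k k - y l l).
  by rewrite !mxE; ring.
rewrite polar_unit_weight // (weight_const b nkl n0max) !mxE !andbb.
by rewrite !(eq_sym i); apply/eqP; ring.
Qed.
End Reduced.

(** With B(E_l, b) scalar, the identity for (b, E_l) reduces to [T(b), E_l], hence
    T(b) is diagonal, and so is B by polarisation. For the equality of the
    diagonal entries k and l, b commutes with T(b), which settles b_kl <> 0,
    and otherwise B(b, e_kl) contributes a multiple of b_kl = 0 to the identity
    for (b, e_kl). *)
Lemma polar_scalar_trace :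
  (forall i b, is_scalar_mx (polar q (E i) b)) ->
  forall b, is_scalar_mx (q b b).
Proof.
move=> scal.
have dT b : is_diag_mx (q b b).
  apply/offdiagP => k l nkl; have := polarization2 b (E l) nkl.
  rewrite lie_bracket_unitE unit_sign_l // mul1r polarC.
  rewrite [lie_bracket (polar _ _ _) _]scalar_bracket; last exact: scal.
  by rewrite mxE addr0.
have dB b c : is_diag_mx (polar q b c).
  apply/offdiagP => k l nkl.
  have -> : polar q b c = q (b + c) (b + c) - q b b - q c c.
    rewrite /polar linearDl !linearDr /=.
    by apply/matrixP => i j; rewrite !mxE; ring.
  by rewrite !mxE !(offdiagP _ (dT _)) // !subr0.
move=> b; apply: diag_const_scalar => // k l nkl; apply/eqP; rewrite -subr_eq0.
have [b0|nb0] := eqVneq (b k l) 0; last first.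
  by apply/eqP/(mulIf nb0); rewrite -lie_bracket_diagE // qC // mul0r.
have := polarization2 b (delta_mx k l) nkl.
rewrite !lie_bracket_diagE // delta_mx_supp b0 mulr0 addr0 mulr1 => ->.
exact: eqxx.
Qed.

End Polarization.

(** * Subtracting a proper part *)

Section Shift.
Variables (R : comNzRingType) (A : algType R).

Definition bishift (q : {bilinear A -> A -> A}) (z : R) (mu : {scalar A}) a b :=
  q a b - z *: (a * b) - mu a *: b.

Lemma bishift_is_bilinear q z mu : bilinear_for *:%R *:%R (bishift q z mu).
Proof.
have sub c (x x' y y' : A) :
    (c *: x + x') - (c *: y + y') = c *: (x - y) + (x' - y').
  by rewrite scalerBr opprD addrACA.
split=> a c x y; rewrite /bishift.
  have -> : z *: ((c *: x + y) * a) = c *: (z *: (x * a)) + z *: (y * a).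
    by rewrite mulrDl scalerDr -scalerAl !scalerA mulrC.
  by rewrite linearPl (linearP mu) /= scalerDl -scalerA !sub.
have -> : z *: (a * (c *: x + y)) = c *: (z *: (a * x)) + z *: (a * y).
  by rewrite mulrDr scalerDr -scalerAr !scalerA mulrC.
have -> : mu a *: (c *: x + y) = c *: (mu a *: x) + mu a *: y.
  by rewrite scalerDr !scalerA mulrC.
by rewrite linearPr /= !sub.
Qed.

HB.instance Definition _ q z mu :=
  bilinear_isBilinear.Build R A A A *:%R *:%R (bishift q z mu)
    (bishift_is_bilinear q z mu).

Lemma bishift_bracket q z mu a :
  lie_bracket (bishift q z mu a a) a = lie_bracket (q a a) a.
Proof.
have bracketZ c x : lie_bracket x a = 0 -> lie_bracket (c *: x) a = 0.
  move=> xa; rewrite /lie_bracket -scalerAl -scalerAr -scalerBr.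
  by rewrite -/(lie_bracket x a) xa scaler0.
rewrite /bishift !lie_bracketDl !lie_bracketNl.
by rewrite !bracketZ ?subr0 /lie_bracket ?mulrA ?subrr.
Qed.

Lemma in_centerD x y : in_center x -> in_center y -> in_center (x + y :> A).
Proof. by move=> xC yC a; apply/commr_sym/commrD; apply/commr_sym. Qed.

Lemma in_centerZ1 c : in_center (c *: 1 : A).
Proof. by move=> a; rewrite /GRing.comm -scalerAl -scalerAr mul1r mulr1. Qed.

Definition scalar_map (nu : {linear A -> A}) (mu : {scalar A}) a : A :=
  nu a + mu a *: 1.

Lemma scalar_map_is_linear nu mu : linear (scalar_map nu mu).
Proof.
move=> c x y; rewrite /scalar_map !linearP /= scalerDl scalerDr scalerA.
by rewrite addrACA.
Qed.

HB.instance Definition _ nu mu :=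
  GRing.isLinear.Build R A A *:%R (scalar_map nu mu) (scalar_map_is_linear nu mu).

Lemma proper_bishift q z mu :
  proper_trace (bitrace (bishift q z mu)) -> proper_trace (bitrace q).
Proof.
move=> [z' [nu [p [z'C nuC pC properE]]]].
exists (z' + z *: 1), (scalar_map nu mu), p; split=> //.
- by apply: in_centerD z'C _; apply: in_centerZ1.
- by move=> a; apply: in_centerD (nuC a) _; apply: in_centerZ1.
move=> a; have := properE a; rewrite /bitrace /bishift /scalar_map.
move/eqP; rewrite !subr_eq !mulrDl -!scalerAl !mul1r expr2 => /eqP ->.
by rewrite [in RHS]addrACA [RHS]addrAC (addrC (z *: _)) !addrA.
Qed.

End Shift.

(** * Properness *)

Section Properness.
Variables (R : idomainType) (hR : two_torsionfree R) (m : nat).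
Local Notation A := 'M[R]_m.+1.

(** A bilinear map into the center with the same trace as q whenever that trace
    is scalar; q itself need not have central values. *)
Definition entry00 (q : {bilinear A -> A -> A}) a b : A := (q a b 0 0)%:M.

Lemma entry00_is_bilinear q : bilinear_for *:%R *:%R (entry00 q).
Proof.
split=> a c x y; rewrite /entry00 (linearPl, linearPr) /=;
by apply/matrixP => i j; rewrite !mxE mulrnDl mulrnAr.
Qed.

HB.instance Definition _ q :=
  bilinear_isBilinear.Build R A A A *:%R *:%R (entry00 q) (entry00_is_bilinear q).

Lemma scalar_trace_proper (q : {bilinear A -> A -> A}) :
  (forall a, is_scalar_mx (q a a)) -> proper_trace (bitrace q).
Proof.
move=> scal; exists 0, \0, (entry00 q); split=> [||a b|a].
- by move=> a; rewrite /GRing.comm mul0r mulr0.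
- by move=> a b; rewrite /GRing.comm mul0r mulr0.
- exact: scalar_mx_center.
rewrite !mul0r !add0r /bitrace /= /entry00.
by have /is_scalar_mxP[c ->] := scal a; rewrite mxE eqxx.
Qed.

Definition diag_form (mu : 'I_m.+1 -> R) (a : A) := \sum_i mu i * a i i.

Lemma diag_form_is_linear mu : linear_for *%R (diag_form mu).
Proof.
move=> c x y; rewrite /diag_form mulr_sumr -big_split /=.
by apply: eq_bigr => i _; rewrite !mxE; ring.
Qed.

HB.instance Definition _ mu :=
  GRing.isLinear.Build R A R *%R (diag_form mu) (diag_form_is_linear mu).

Lemma offdiag_commuting_bishift (q : {bilinear A -> A -> A}) z mu :
  offdiag_commuting q -> offdiag_commuting (bishift q z mu).
Proof. by move=> qC a k l nkl; rewrite bishift_bracket qC. Qed.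

(** The right-hand side has exactly the shape found in [gap_coefE], so the shift
    can cancel all these coefficients; the term mu(e_kl) E_i has no entry
    at (k, l). *)
Lemma gap_coef_bishift (q : {bilinear A -> A -> A}) z mu k l i : k != l ->
  gap_coef (bishift q z mu) k l i
    = gap_coef q k l i - z * ((i == k)%:R + (i == l)%:R) - mu (delta_mx i i).
Proof.
move=> nkl; rewrite /gap_coef /polar /= /bishift.
have -> : delta_mx i i * delta_mx k l = delta_mx i l *+ (i == k) :> A.
  exact: mul_delta_mx_cond.
have -> : delta_mx k l * delta_mx i i = delta_mx k i *+ (l == i) :> A.
  exact: mul_delta_mx_cond.
have /negPf nikl : ~~ ((i == k) && (i == l)).
  by apply: contraNN nkl => /andP[/eqP<- /eqP<-].
rewrite !mxE !eqxx !(eq_sym _ i) nikl andbT.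
rewrite !mulmxnE !mxE !eqxx !(eq_sym _ i) andbT /=.
by case: (i == k); case: (i == l); rewrite /= ?mulr1n ?mulr0n; ring.
Qed.

(** The second shift keeps B(E_i, b) scalar up to w: since w(E_i) = 0, it takes off
    w(b) E_i and nothing else. *)
Lemma gap_free_proper (q : {bilinear A -> A -> A}) :
  offdiag_commuting q -> (forall k l i, k != l -> gap_coef q k l i = 0) ->
  proper_trace (bitrace q).
Proof.
move=> qC gap0; have [w [w0 wE]] := polar_unitlE hR qC gap0.
apply: (@proper_bishift _ _ _ 0 w); apply: scalar_trace_proper.
apply: (polar_scalar_trace hR); first exact: offdiag_commuting_bishift.
move=> i b; have := wE i b; congr is_scalar_mx.
by rewrite /polar /= /bishift w0 !scale0r !subr0 addrA.
Qed.

Lemma offdiag_commuting_proper (q : {bilinear A -> A -> A}) :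
  offdiag_commuting q -> proper_trace (bitrace q).
Proof.
move=> qC; have [z [mu gapE]] := gap_coefE hR qC.
apply: (@proper_bishift _ _ _ z (diag_form mu)); apply: gap_free_proper.
  exact: offdiag_commuting_bishift.
move=> k l i nkl; rewrite gap_coef_bishift // gapE // /= /diag_form (bigD1 i) //=.
rewrite big1 => [|j nji]; first by rewrite mxE !eqxx mulr1; ring.
by rewrite mxE (negPf nji) mulr0.
Qed.
End Properness.

Theorem corollary3p22 (R : idomainType) (hR : two_torsionfree R) (n : nat)
    (q : {bilinear 'M[R]_n.+1 -> 'M[R]_n.+1 -> 'M[R]_n.+1}) :
  centralizing_trace (bitrace q) -> proper_trace (bitrace q).
Proof.
move=> qC; apply: offdiag_commuting_proper => // a k l nkl.
exact: central_offdiag (qC a) nkl.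
Qed.
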